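(* Let $\Gamma$ be a discrete group, let $\Sigma=\{F_n\}_{n=1}^\infty$ be a sequence of nonempty finite subsets of $\Gamma$, and let $b\in\Gamma$. Let $\Lambda\subseteq\Gamma$ have positive upper density with respect to $\Sigma$, i.e. $\limsup_{n\to\infty}\frac{|F_n\cap\Lambda|}{|F_n|}>0$. (a) If $b$ fixes $\Sigma$ from the right, i.e. $\lim_{n\to\infty}\frac{|bF_n\,\Delta\, F_n|}{|F_n|}=0$, then for every positive integer $k$ there exist an integer $n>0$ and $a\in\Gamma$ such that $\{b^{jn}a\}_{j=0}^{k-1}\subseteq\Lambda$. (b) If $b$ fixes $\Sigma$ from the left, i.e. $\lim_{n\to\infty}\frac{|F_nb\,\Delta\, F_n|}{|F_n|}=0$, then for every positive integer $k$ there exist an integer $n>0$ and $a\in\Gamma$ such that $\{ab^{jn}\}_{j=0}^{k-1}\subseteq\Lambda$.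
   Context: $\Delta$ denotes symmetric difference of sets and $|\cdot|$ cardinality. *)

(* Defs.v *)
From HB Require Import structures.
From mathcomp Require Import all_boot all_order all_algebra.
From mathcomp Require Import finmap.
From mathcomp Require Import all_classical all_reals all_analysis.
Set Implicit Arguments. Unset Strict Implicit. Unset Printing Implicit Defensive.
Import Order.TTheory GRing.Theory Num.Theory.
Local Open Scope fset_scope.

Definition fsymdiff (K : choiceType) (A B : {fset K}) : {fset K} :=
  (A `\` B) `|` (B `\` A).

Definition ltrans (G : groupType) (b : G) (F : {fset G}) : {fset G} :=
  [fset (b * x)%g | x in F].
Definition rtrans (G : groupType) (b : G) (F : {fset G}) : {fset G} :=
  [fset (x * b)%g | x in F].

Definition dens_ratio (R : realType) (G : groupType) (L : pred G) (F : {fset G}) : R :=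
  ((#|` [fset x in F | L x]|)%:R / (#|` F|)%:R)%R.

Definition sd_ratio (R : realType) (G : groupType) (A F : {fset G}) : R :=
  ((#|` fsymdiff A F|)%:R / (#|` F|)%:R)%R.

(* Main.v *)
Require Import Defs.
From HB Require Import structures.
From mathcomp Require Import all_boot all_order all_algebra.
From mathcomp Require Import finmap.
From mathcomp Require Import all_classical all_reals all_analysis.
From mathcomp Require Import ring lra zify.
Import Order.TTheory GRing.Theory Num.Theory.
Import numFieldNormedType.Exports.
Set Implicit Arguments.
Unset Strict Implicit.
Local Open Scope classical_set_scope.
Local Open Scope ring_scope.

(** Write T for the translation by b. If F_n is almost T-invariant and L has density
    delta in F_n, then averaging over a in F_n gives a point a for which the words w
    over {0, .., k-1} with T^(w_1 + .. + w_N) a in L have density at least delta/2. A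
    combinatorial line of such words is a progression as required, so the theorem
    follows from the density Hales-Jewett theorem.

    The latter is proved by induction on the alphabet, from k to k+1 letters, along
    the lines of Polymath and of Dodos, Kanellopoulos and Tyros. Let delta be the
    infimum of the densities that force a line, and let A be a line-free set of
    density close to delta. Then all sections of A at a bounded number of
    coordinates have density close to delta. The theorem for k letters and the
    Hales-Jewett theorem produce a subspace all of whose points w, the letter k
    being read as a wildcard, satisfy: for a positive proportion theta of the
    remaining coordinates y, the k points (w(i), y) with i < k lie in A. As A has no
    line, (w, y) is then outside A, so A has density at least delta (1 + theta),
    roughly, on the complement of the set of these (w, y). That complement is a
    union of intersections of sets that are insensitive to the exchange of a letter
    i < k with k. By the theorem for k letters, such intersections can be almost
    partitioned into subspaces of large dimension, so A has density larger than delta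
    on one of them, which contradicts the choice of delta. *)

(** * Words and templates *)

Fixpoint words (k n : nat) : seq (seq nat) :=
  if n is n'.+1 then [seq a :: w | a <- iota 0 k, w <- words k n'] else [:: [::]].

Lemma mem_words k n w :
  (w \in words k n) = (size w == n) && all (fun a => a < k)%N w.
Proof.
elim: n w => [|n IH] w /=; first by rewrite inE; case: w.
apply/allpairsP/idP => [[[a v] /= []]|].
  by rewrite mem_iota add0n leq0n IH /= => ak /andP[/eqP<- va] -> /=; rewrite eqxx ak va.
case: w => [//|a w] /=; rewrite eqSS => /and3P[sw aw ww].
by exists (a, w); rewrite /= mem_iota add0n aw IH sw ww.
Qed.

Lemma wordsP k n w :
  reflect (size w = n /\ forall a, a \in w -> (a < k)%N) (w \in words k n).
Proof.
rewrite mem_words; apply: (iffP andP) => -[].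
  by move=> /eqP -> /allP.
by move=> -> h; split=> //; apply/allP.
Qed.

Lemma words_uniq k n : uniq (words k n).
Proof.
elim: n => //= n IH; apply: allpairs_uniq => //; first exact: iota_uniq.
by move=> [a v] [b w] _ _ /= [-> ->].
Qed.

Lemma size_words k n : size (words k n) = (k ^ n)%N.
Proof. by elim: n => //= n IH; rewrite size_allpairs size_iota IH expnS. Qed.

Lemma words_size k n w : w \in words k n -> size w = n.
Proof. by case/wordsP. Qed.

Lemma words_cat k m n x y :
  x \in words k m -> y \in words k n -> x ++ y \in words k (m + n).
Proof.
move=> /wordsP[<- hx] /wordsP[<- hy]; apply/wordsP; rewrite size_cat; split=> // a.
by rewrite mem_cat => /orP[/hx|/hy].
Qed.

Lemma words_widen k l n w : (k <= l)%N -> w \in words k n -> w \in words l n.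
Proof.
move=> kl /wordsP[s h]; apply/wordsP; split=> // a /h ak.
exact: leq_trans ak kl.
Qed.

Lemma words_nth k n w j : w \in words k n -> (j < n)%N -> (nth 0%N w j < k)%N.
Proof. by case/wordsP=> <- h jn; apply: h; rewrite mem_nth. Qed.

Lemma words_nseq k n a : (a < k)%N -> nseq n a \in words k n.
Proof. by move=> ak; apply/wordsP; rewrite size_nseq; split=> // b /nseqP[->]. Qed.

Lemma words_cons k n a w : (a < k)%N -> w \in words k n -> a :: w \in words k n.+1.
Proof. by rewrite !mem_words /= eqSS => -> ->. Qed.

Lemma words_consE k n w :
  w \in words k n.+1 -> exists a v, [/\ w = a :: v, (a < k)%N & v \in words k n].
Proof.
rewrite mem_words; case: w => //= a w; rewrite eqSS => /and3P[sw aw ww].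
by exists a, w; rewrite mem_words sw ww.
Qed.

(* A combinatorial subspace of dimension d is given by a template: a word over k + d
   letters, in which the letter k + j stands for the j-th variable and each variable
   occurs. The function sub is both the evaluation and the composition of templates.
   A word over k.+1 letters in which k occurs is thus a line over k letters. *)
Definition sub (k : nat) (U z : seq nat) : seq nat :=
  [seq (if (c < k)%N then c else nth 0%N z (c - k)) | c <- U].

Definition tmpl (k d n : nat) (U : seq nat) : bool :=
  (U \in words (k + d) n) && all (fun c => c \in U) (iota k d).

(** Frees the code [k]: read over k letters it becomes a new first variable, read over k.+1 letters
    a letter that V does not use. *)
Definition shift (k : nat) (V : seq nat) : seq nat :=
  [seq (if (c < k)%N then c else c.+1) | c <- V].

Lemma tmplP k d n U :
  reflect (U \in words (k + d) n /\ forall j, (j < d)%N -> (k + j)%N \in U)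
          (tmpl k d n U).
Proof.
apply: (iffP andP) => -[hU h]; split=> //.
  by move=> j jd; apply: (allP h); rewrite mem_iota; lia.
apply/allP=> c; rewrite mem_iota => /andP[kc ck].
by rewrite -(subnKC kc); apply: h; lia.
Qed.

Lemma tmpl_words k d n U : tmpl k d n U -> U \in words (k + d) n.
Proof. by case/andP. Qed.

Lemma tmpl_size k d n U : tmpl k d n U -> size U = n.
Proof. by move/tmpl_words/words_size. Qed.

Lemma sub_cat k U V z : sub k (U ++ V) z = sub k U z ++ sub k V z.
Proof. by rewrite /sub map_cat. Qed.

Lemma size_sub k U z : size (sub k U z) = size U.
Proof. by rewrite size_map. Qed.

Lemma sub_id k n w z : w \in words k n -> sub k w z = w.
Proof.
move=> /wordsP[_ h]; rewrite /sub -[RHS]map_id; apply/eq_in_map => c /h.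
by move=> ->.
Qed.

Lemma sub_words k l d n U z : (k <= l)%N ->
  U \in words (k + d) n -> z \in words l d -> sub k U z \in words l n.
Proof.
move=> kl /wordsP[<- hU] hz; apply/wordsP; rewrite size_sub; split=> // a.
move=> /mapP[c /hU ck ->]; case: (ltnP c k) => kc; first exact: leq_trans kc kl.
by apply: (words_nth hz); lia.
Qed.

Lemma sub_sub k l d n U V z : (k <= l)%N -> U \in words (k + d) n -> size V = d ->
  sub l (sub k U V) z = sub k U (sub l V z).
Proof.
move=> kl /wordsP[_ hU] sV; rewrite /sub -map_comp; apply/eq_in_map => c /hU ck /=.
case: (ltnP c k) => kc; first by rewrite (leq_trans kc kl).
by rewrite (nth_map 0%N) // sV; lia.
Qed.

Lemma mem_sub k d n U z c : tmpl k d n U -> size z = d -> c \in z -> c \in sub k U z.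
Proof.
move=> /tmplP[hU h] sz cz.
have jd : (index c z < d)%N by rewrite -sz index_mem.
apply/mapP; exists (k + index c z)%N; first exact: h.
by rewrite ltnNge leq_addr /= addKn nth_index.
Qed.

Lemma tmpl_comp k d e n U V : tmpl k d n U -> tmpl k e d V -> tmpl k e n (sub k U V).
Proof.
move=> tU /tmplP[hV h]; apply/tmplP; split.
  by apply: sub_words (tmpl_words tU) hV; lia.
by move=> j jd; apply: (mem_sub tU); rewrite ?(words_size hV) ?h.
Qed.

Lemma sub_inj k d n U z z' : tmpl k d n U -> size z = d -> size z' = d ->
  sub k U z = sub k U z' -> z = z'.
Proof.
move=> /tmplP[_ h] sz sz' /eq_in_map e.
apply: (@eq_from_nth _ 0%N); first by rewrite sz'.
move=> i; rewrite sz => /h /e; by rewrite ltnNge leq_addr /= addKn.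
Qed.

Lemma tmpl_prefix k d m n x U : x \in words k m -> tmpl k d n U -> tmpl k d (m + n) (x ++ U).
Proof.
move=> hx /tmplP[hU h]; apply/tmplP; split.
  by apply: words_cat hU; apply: words_widen hx; lia.
by move=> j /h jU; rewrite mem_cat jU orbT.
Qed.

Lemma tmpl_suffix k d m n y U : y \in words k n -> tmpl k d m U -> tmpl k d (m + n) (U ++ y).
Proof.
move=> hy /tmplP[hU h]; apply/tmplP; split.
  by apply: words_cat hU _; apply: words_widen hy; lia.
by move=> j /h jU; rewrite mem_cat jU.
Qed.

Lemma tmpl_vars k d : tmpl k d d (iota k d).
Proof.
apply/tmplP; split; last by move=> j jd; rewrite mem_iota; lia.
by apply/wordsP; rewrite size_iota; split=> // a; rewrite mem_iota; lia.
Qed.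

Lemma sub_vars k d z : size z = d -> sub k (iota k d) z = z.
Proof.
move=> <-; apply: (@eq_from_nth _ 0%N); rewrite size_sub size_iota // => i hi.
by rewrite (nth_map 0%N) ?size_iota // nth_iota // ltnNge leq_addr /= addKn.
Qed.

Lemma tmpl_exists k d n : (0 < k)%N -> (d <= n)%N -> exists V, tmpl k d n V.
Proof.
move=> k0 dn; exists (iota k d ++ nseq (n - d) 0%N).
by rewrite -(subnKC dn) addKn; apply: tmpl_suffix (tmpl_vars _ _); apply: words_nseq.
Qed.

Lemma sub_shift_cons k V a z : sub k (shift k V) (a :: z) = sub k V z.
Proof.
rewrite /sub -map_comp; apply: eq_map => c /=.
case: (ltnP c k) => kc; first by rewrite kc.
by rewrite ltnNge leqW //= subSn.
Qed.

Lemma sub_shift k V z : sub k.+1 (shift k V) z = sub k V z.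
Proof.
rewrite /sub -map_comp; apply: eq_map => c /=.
case: (ltnP c k) => kc; first by rewrite leqW.
by rewrite ltnS ltnNge kc /= subSS.
Qed.

Lemma shift_words k d n V : V \in words (k + d) n -> shift k V \in words (k + d).+1 n.
Proof.
move=> /wordsP[s h]; apply/wordsP; rewrite size_map; split=> // a.
by move=> /mapP[c /h]; case: (ltnP c k) => ? ? ->; lia.
Qed.

Lemma mem_shift k V j : (k + j)%N \in V -> (k + j).+1 \in shift k V.
Proof. by move=> h; apply/mapP; exists (k + j)%N => //; rewrite ltnNge leq_addr. Qed.

Lemma tmpl_shift k d n V : tmpl k d n V -> tmpl k.+1 d n (shift k V).
Proof.
move=> /tmplP[/shift_words hV h]; apply/tmplP; split; first by rewrite addSn.
by move=> j /h; rewrite addSn; apply: mem_shift.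
Qed.

Lemma tmpl_line_cat k d m n X V : tmpl k 1 m X -> tmpl k d n V ->
  tmpl k d.+1 (m + n) (X ++ shift k V).
Proof.
move=> /tmplP[hX h1] /tmplP[/shift_words hV h]; apply/tmplP; split.
  by rewrite addnS; apply: words_cat hV; apply: words_widen hX; lia.
case=> [_|j]; rewrite mem_cat; first by rewrite h1.
by rewrite ltnS addnS => /h/mem_shift ->; rewrite orbT.
Qed.

Lemma sub_line_cat k m X V e z : X \in words (k + 1) m ->
  sub k (X ++ shift k V) (e :: z) = sub k X [:: e] ++ sub k V z.
Proof.
move=> /wordsP[_ hX]; rewrite sub_cat sub_shift_cons; congr (_ ++ _).
apply/eq_in_map => c /hX ck; case: (ltnP c k) => // kc.
by have -> : (c - k = 0)%N by lia.
Qed.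

(** * Averages over words *)

Definition avg (R : realType) (k n : nat) (f : seq nat -> R) : R :=
  (\sum_(w <- words k n) f w) / (k ^ n)%:R.

Lemma expn_natr_gt0 (R : realType) k n : (0 < k)%N -> 0 < (k ^ n)%:R :> R.
Proof. by move=> k0; rewrite ltr0n expn_gt0 k0. Qed.

Lemma boolr_le1 (R : realType) (b : bool) : b%:R <= 1 :> R.
Proof. by case: b. Qed.

Lemma le_avg (R : realType) k n (f g : seq nat -> R) :
  (forall w, w \in words k n -> f w <= g w) -> avg k n f <= avg k n g.
Proof.
move=> h; rewrite /avg ler_wpM2r ?invr_ge0 ?ler0n //.
by rewrite big_seq [leRHS]big_seq; apply: ler_sum.
Qed.

Lemma eq_avg (R : realType) k n (f g : seq nat -> R) :
  (forall w, w \in words k n -> f w = g w) -> avg k n f = avg k n g.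
Proof. by move=> h; rewrite /avg; congr (_ / _); apply: eq_big_seq. Qed.

Lemma avg_cst (R : realType) k n (c : R) : (0 < k)%N -> avg k n (fun=> c) = c.
Proof.
move=> k0; rewrite /avg big_const_seq count_predT size_words iter_addr_0.
by rewrite -[c *+ _]mulr_natr mulfK // gt_eqF // expn_natr_gt0.
Qed.

Lemma avgD (R : realType) k n (f g : seq nat -> R) :
  avg k n (fun w => f w + g w) = avg k n f + avg k n g.
Proof. by rewrite /avg big_split mulrDl. Qed.

Lemma avgZ (R : realType) k n c (f : seq nat -> R) :
  avg k n (fun w => c * f w) = c * avg k n f.
Proof. by rewrite /avg -mulr_sumr mulrA. Qed.

Lemma avgB (R : realType) k n (f g : seq nat -> R) :
  avg k n (fun w => f w - g w) = avg k n f - avg k n g.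
Proof. by rewrite /avg sumrB mulrBl. Qed.

Lemma avg_sum (R : realType) k n (T : Type) (s : seq T) (f : T -> seq nat -> R) :
  avg k n (fun w => \sum_(L <- s) f L w) = \sum_(L <- s) avg k n (f L).
Proof. by rewrite /avg exchange_big mulr_suml. Qed.

Lemma avg_swap (R : realType) k m l n (f : seq nat -> seq nat -> R) :
  avg k m (fun x => avg l n (f x)) = avg l n (fun y => avg k m (fun x => f x y)).
Proof.
rewrite /avg -!mulr_suml exchange_big /= -!mulrA; congr (_ * _); exact: mulrC.
Qed.

Lemma avg_cat (R : realType) k m n (f : seq nat -> R) :
  avg k (m + n) f = avg k m (fun x => avg k n (fun y => f (x ++ y))).
Proof.
rewrite /avg -mulr_suml expnD natrM invfM mulrA mulrAC; congr (_ / _ / _).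
elim: m f => [|m IH] f; first by rewrite big_seq1.
rewrite addSn /= !big_allpairs_dep /=; apply: eq_bigr => a _.
by rewrite IH.
Qed.

Lemma avg_ge0 (R : realType) k n (f : seq nat -> R) :
  (forall w, w \in words k n -> 0 <= f w) -> 0 <= avg k n f.
Proof.
move=> h; rewrite /avg divr_ge0 ?ler0n // big_seq; exact: sumr_ge0.
Qed.

Lemma avg_le (R : realType) k n (c : R) (f : seq nat -> R) : (0 < k)%N ->
  (forall w, w \in words k n -> f w <= c) -> avg k n f <= c.
Proof. by move=> k0 h; rewrite -[leRHS](avg_cst n c k0); apply: le_avg. Qed.

Lemma avg_ge (R : realType) k n (c : R) (f : seq nat -> R) : (0 < k)%N ->
  (forall w, w \in words k n -> c <= f w) -> c <= avg k n f.
Proof. by move=> k0 h; rewrite -[leLHS](avg_cst n c k0); apply: le_avg. Qed.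

Lemma avg_exists (R : realType) k n (c : R) (f : seq nat -> R) : (0 < k)%N ->
  c < avg k n f -> exists2 w, w \in words k n & c < f w.
Proof.
move=> k0; apply: contraPP => h; apply/negP; rewrite -leNgt.
apply: avg_le => // w hw; rewrite leNgt; apply/negP => cf; apply: h; by exists w.
Qed.

Lemma avg_pred_exists (R : realType) k n (A : pred (seq nat)) : (0 < k)%N ->
  0 < avg k n (fun w => (A w)%:R : R) -> exists2 w, w \in words k n & A w.
Proof.
move=> k0 /(avg_exists k0)[w hw]; rewrite ltr0n lt0b; by exists w.
Qed.

(** Every variable occurs in U, so [sub k U] is injective and the sum over the subspace is a sum
    over [words k d]; the factor is the density of the subspace. *)
Lemma avg_image (R : realType) k d n U (f : seq nat -> R) : (0 < k)%N -> tmpl k d n U ->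
  avg k n (fun x => (x \in [seq sub k U z | z <- words k d])%:R * f x)
  = (k ^ d)%:R / (k ^ n)%:R * avg k d (fun z => f (sub k U z)).
Proof.
move=> k0 tU; rewrite /avg.
have E (a b c : R) : 0 < a -> a / b * (c / a) = c / b.
  by move=> a0; rewrite mulrC mulrA divfK // gt_eqF.
rewrite E ?expn_natr_gt0 //; congr (_ / _); rewrite -(big_map (sub k U) xpredT f) /=.
under eq_bigr => x _ do rewrite mulr_natl mulrb.
rewrite -big_mkcond -big_filter; apply: perm_big; apply: uniq_perm.
- by rewrite filter_uniq // words_uniq.
- rewrite map_inj_in_uniq ?words_uniq // => z z' /words_size sz /words_size sz'.
  exact: sub_inj tU sz sz'.
move=> x; rewrite mem_filter andb_idr // => /mapP[z hz ->].
exact: sub_words (tmpl_words tU) hz.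
Qed.

Lemma avg_markov (R : realType) k n (s : R) (f : seq nat -> R) : (0 < k)%N -> 0 <= s ->
  (forall w, w \in words k n -> f w <= 1) ->
  avg k n f <= avg k n (fun w => (s <= f w)%R%:R) + s.
Proof.
move=> k0 s0 h; rewrite -[X in _ <= _ + X](avg_cst n s k0) -avgD; apply: le_avg => w /h f1.
by case: (leP s (f w)) => /=; lra.
Qed.

(** Union bound: if every L had less than the share [c / size Ls], the shares would add up to less
    than c. *)
Lemma avg_pigeonhole (R : realType) k n (T : eqType) (Ls : seq T) (Y : pred (seq nat))
    (P : T -> pred (seq nat)) (c : R) :
  0 < c -> (forall y, y \in words k n -> Y y -> exists2 L, L \in Ls & P L y) ->
  c <= avg k n (fun y => (Y y)%:R) ->
  exists2 L, L \in Ls & c / (size Ls)%:R <= avg k n (fun y => (P L y)%:R).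
Proof.
move=> c0 h cY; apply: contrapT => H.
have hlt L : L \in Ls -> avg k n (fun y => (P L y)%:R) < c / (size Ls)%:R.
  by move=> LLs; rewrite ltNge; apply/negP => ?; apply: H; exists L.
have : avg k n (fun y => (Y y)%:R : R) <= \sum_(L <- Ls) avg k n (fun y => (P L y)%:R).
  rewrite -avg_sum; apply: le_avg => y hy.
  case: (boolP (Y y)) => [Yy|_] /=; last by apply: sumr_ge0 => L _; rewrite ler0n.
  have [L LLs PL] := h y hy Yy.
  by rewrite (big_rem L) //= PL lerDl; apply: sumr_ge0 => ? _; rewrite ler0n.
move=> /(le_trans cY); apply/negP; rewrite -ltNge.
case: Ls => [|L0 Ls] in h H hlt *; first by rewrite big_nil.
apply: lt_le_trans (_ : \sum_(L <- L0 :: Ls) (c / (size (L0 :: Ls))%:R) <= _).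
  rewrite !big_cons; apply: ltr_leD; first by apply: hlt; rewrite mem_head.
  rewrite big_seq [leRHS]big_seq; apply: ler_sum => L LLs; apply: ltW; apply: hlt.
  by rewrite inE LLs orbT.
rewrite big_const_seq count_predT iter_addr_0 -[_ *+ _]mulr_natr divfK //.
by rewrite pnatr_eq0.
Qed.

(** * The Hales-Jewett theorem *)

Definition collapse (k : nat) (w : seq nat) : seq nat :=
  [seq (if c == k.+1 then k else c) | c <- w].

Lemma collapse_words k n w : w \in words k.+2 n -> collapse k w \in words k.+1 n.
Proof.
move=> /wordsP[<- h]; apply/wordsP; rewrite size_map; split=> // a.
by move=> /mapP[c /h ck ->]; case: eqP => ?; lia.
Qed.

Lemma collapse_sub_shift k d n V z : V \in words (k.+1 + d) n -> size z = d ->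
  collapse k (sub k.+2 (shift k.+1 V) z) = sub k.+1 V (collapse k z).
Proof.
move=> /wordsP[_ hV] sz; rewrite sub_shift /sub /collapse -map_comp.
apply/eq_in_map => c /hV hc /=; case: (ltnP c k.+1) => ck; first by case: eqP => //; lia.
by rewrite (nth_map 0%N) // sz; lia.
Qed.

(* Shelah's insensitivity step: on a long enough block, two of the words made of
   copies of k.+1 followed by copies of k get the same colour whatever the
   other blocks are. *)
Lemma collapse_invariant_tmpl k h (C : finType) : exists n, forall c : seq nat -> C,
  exists2 U, tmpl k.+2 h n U &
    forall z, z \in words k.+2 h -> c (sub k.+2 U z) = c (sub k.+2 U (collapse k z)).
Proof.
elim: h C => [|h IH] C.
  by exists 0%N => c; exists [::] => // z /wordsP[/size0nil -> _].
(* The number of colourings of [words k.+2 h]; two of the a + 1 words [xj j] below must therefore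
   induce the same one. *)
pose a := #|{: (size (words k.+2 h)).-tuple C}|.
(* The colours are now vectors indexed by all words on the first block, so that insensitivity holds
   whatever that block contains. *)
have [b hb] := IH [the finType of (size (words k.+2 a)).-tuple C].
exists (a + b)%N => c.
have [Y tY hY] := hb (fun y => map_tuple (fun x => c (x ++ y)) (in_tuple (words k.+2 a))).
have {}hY x z : x \in words k.+2 a -> z \in words k.+2 h ->
    c (x ++ sub k.+2 Y z) = c (x ++ sub k.+2 Y (collapse k z)).
  move=> hx /hY /(congr1 val) /= /eq_in_map; exact.
pose xj (j : nat) := nseq j k.+1 ++ nseq (a - j) k.
pose col (j : 'I_a.+1) :=
  map_tuple (fun z => c (xj j ++ sub k.+2 Y z)) (in_tuple (words k.+2 h)).
have : ~~ injectiveb col.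
  apply/negP => /injectiveP inj; have := leq_card _ inj.
  by rewrite card_ord ltnn.
case/injectivePn => i0 [j0 ij ecol].
have [i [j [ilj ja ec]]] : exists i j, [/\ (i < j)%N, (j <= a)%N &
    forall z, z \in words k.+2 h -> c (xj i ++ sub k.+2 Y z) = c (xj j ++ sub k.+2 Y z)].
  have ec : forall z, z \in words k.+2 h ->
      c (xj i0 ++ sub k.+2 Y z) = c (xj j0 ++ sub k.+2 Y z).
    by move: ecol => /(congr1 val) /= /eq_in_map.
  case: (ltngtP i0 j0) => [lt|lt|e].
  - by exists i0, j0; split=> //; rewrite -ltnS.
  - by exists j0, i0; split=> // [|z /ec //]; rewrite -ltnS.
  - by case/eqP: ij; apply: val_inj.
(* A line through both words: its value at [k] is [xj i], at [k.+1] it is [xj j]. *)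
pose X := nseq i k.+1 ++ nseq (j - i) k.+2 ++ nseq (a - j) k.
have subX e : sub k.+2 X [:: e] = nseq i k.+1 ++ nseq (j - i) e ++ nseq (a - j) k.
  by rewrite !sub_cat /sub !map_nseq ltnn subnn /= ltnSn (ltnW (ltnSn _)).
have tX : tmpl k.+2 1 a X.
  apply/tmplP; split.
    have -> : a = (i + (j - i + (a - j)))%N by lia.
    rewrite /X {1}(_ : a - j = i + (j - i + (a - j)) - j)%N; last by lia.
    by rewrite (_ : _ + _ - j = a - j)%N; [|lia]; do 2?apply: words_cat; apply: words_nseq; lia.
  case=> // _; rewrite /X !mem_cat addn0 !mem_nseq eqxx andbT subn_gt0 ilj orbT //.
exists (X ++ shift k.+2 Y); first exact: tmpl_line_cat.
move=> z /words_consE[e [z' [-> ek hz']]] /=.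
have hX := tmpl_words tX; rewrite !(sub_line_cat _ _ _ hX).
rewrite hY //; last by apply: (sub_words _ hX) => //; apply: words_cons.
case: eqP => // ->; rewrite !subX.
have hcz : collapse k z' \in words k.+2 h by apply: words_widen (collapse_words hz').
have := ec _ hcz; rewrite /xj.
have -> : nseq (a - i) k = nseq (j - i) k ++ nseq (a - j) k.
  by rewrite -nseqD; congr nseq; lia.
have -> : nseq j k.+1 = nseq i k.+1 ++ nseq (j - i) k.+1.
  by rewrite -nseqD; congr nseq; lia.
by rewrite -!catA => ->.
Qed.

(** Induction on the alphabet: on a subspace where the colour is invariant under [collapse], it is
    determined by the words over one letter fewer. *)
Theorem hales_jewett k d (C : finType) : exists n, forall c : seq nat -> C,
  exists2 U, tmpl k.+1 d n U &
    forall z z', z \in words k.+1 d -> z' \in words k.+1 d ->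
      c (sub k.+1 U z) = c (sub k.+1 U z').
Proof.
elim: k C => [|k IH] C.
  exists d => c; exists (iota 1 d); first exact: tmpl_vars.
  suff w1 z : z \in words 1 d -> z = nseq d 0%N by move=> z z' /w1 -> /w1 ->.
  move=> /wordsP[<- h]; apply/all_pred1P; apply/allP => a /h; by case: a.
have [h hh] := IH C; have [n hn] := collapse_invariant_tmpl k h C.
exists n => c; have [U tU hU] := hn c; have [V tV hV] := hh (fun z => c (sub k.+2 U z)).
have tU' := tmpl_words tU; have tV' := tmpl_words tV.
have tsV := tmpl_shift tV; have sV := tmpl_size tsV.
exists (sub k.+2 U (shift k.+1 V)); first exact: tmpl_comp tU tsV.
have red z : z \in words k.+2 d -> c (sub k.+2 (sub k.+2 U (shift k.+1 V)) z)
    = c (sub k.+2 U (sub k.+1 V (collapse k z))).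
  move=> hz; rewrite (sub_sub _ _ tU') // hU; last exact: sub_words (tmpl_words tsV) hz.
  by rewrite (collapse_sub_shift tV') // (words_size hz).
by move=> z z' hz hz'; rewrite !red //; apply: hV; apply: collapse_words.
Qed.

(** * A Ramsey dichotomy for lines *)

Lemma sub_cons_top k Y w : sub k (k :: Y) (k :: w) = k :: sub k.+1 Y w.
Proof.
rewrite /sub /= ltnn subnn /=; congr (_ :: _); apply: eq_map => c.
case: (ltngtP c k) => [ck|kc|->]; [by rewrite leqW| |by rewrite subnn ltnSn].
by rewrite ltnS leqNgt kc (_ : c - k = (c - k.+1).+1)%N //; lia.
Qed.

(* A template over the alphabet k.+1 whose constant letters k are turned into
   an additional first variable is a template over the alphabet k. *)
Lemma tmpl_cons_top k d n Y : tmpl k.+1 d n Y -> tmpl k d.+1 n.+1 (k :: Y).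
Proof.
move=> /tmplP[hY h]; apply/tmplP; split.
  by apply: words_cons; [lia|rewrite addnS -addSn].
by case=> [|j] jd; rewrite inE ?addn0 ?eqxx // addnS -addSn h ?orbT.
Qed.

(** The words in which [k] occurs are lines over k letters, and S calls some of them good. Induction
    on m: either a subspace of good lines turns up, or a subspace with only bad lines gains one more
    dimension. *)
Lemma line_dichotomy k m M : exists n, forall S : pred (seq nat),
  (exists U, [/\ tmpl k.+1 M n U, k \in U &
     forall v, v \in words k.+1 M -> S (sub k.+1 U v)]) \/
  (exists2 U, tmpl k m n U &
     forall w, w \in words k.+1 m -> k \in w -> ~~ S (sub k U w)).
Proof.
elim: m M => [|m IH] M.
  exists 0%N => S; right; exists [::] => // w /wordsP[/size0nil -> _] //.
have [N hN] := hales_jewett k M (option 'I_k).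
have [n0 h0] := IH N; have [n1 h1] := hales_jewett k (n0 + M) bool.
(* The colour of y tells whether the line [k :: y] is good. The dimension [n0 + M] suffices for
   either colour. *)
exists n1.+1 => S; have [Y tY hY] := h1 (fun y => S (k :: y)).
have [V1 tV1] := @tmpl_exists k.+1 M (n0 + M) isT (leq_addl _ _).
have [V2 tV2] := @tmpl_exists k.+1 n0 (n0 + M) isT (leq_addr _ _).
have w0 : nseq (n0 + M) 0%N \in words k.+1 (n0 + M) by apply: words_nseq.
case: (boolP (S (k :: sub k.+1 Y (nseq (n0 + M) 0%N)))) => Sk.
  left; exists (k :: sub k.+1 Y V1); split; last first.
  - move=> v hv; rewrite /= ltnSn (sub_sub _ _ (tmpl_words tY)) ?(tmpl_size tV1) //.
    by rewrite (hY _ _ _ w0) //; apply: sub_words (tmpl_words tV1) hv.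
  - by rewrite mem_head.
  - apply: (@tmpl_prefix k.+1 M 1 n1 [:: k] _ _ (tmpl_comp tY tV1)).
    exact: words_cons.
pose Y' := sub k.+1 Y V2; have tY' : tmpl k.+1 n0 n1 Y' by apply: tmpl_comp tV2.
have bad z : z \in words k.+1 n0 -> ~~ S (k :: sub k.+1 Y' z).
  move=> hz; rewrite (sub_sub _ _ (tmpl_words tY)) ?(tmpl_size tV2) //.
  by rewrite (hY _ _ _ w0) //; apply: sub_words (tmpl_words tV2) hz.
have tkY := tmpl_cons_top tY'; have wkY := tmpl_words tkY.
(* The first variable of [k :: Y'] now takes a constant value: w counts as good if some i < k in
   front of it gives a good line. *)
case: (h0 (fun w => [exists i : 'I_k, S (sub k (k :: Y') (val i :: w))])).
  move=> [U [tU kU hU]]; left.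
  (* The colour is a choice of i, made constant by the theorem of Hales and Jewett; [hU] excludes
     the colour [None]. *)
  have [V tV hV] := hN (fun v => [pick i : 'I_k | S (sub k (k :: Y') (val i :: sub k.+1 U v))]).
  have [i hi] : exists i : 'I_k, forall v, v \in words k.+1 M ->
      S (sub k (k :: Y') (val i :: sub k.+1 U (sub k.+1 V v))).
    have wM : nseq M 0%N \in words k.+1 M by apply: words_nseq.
    have := hV _ _ wM; case: pickP => [i Si|none] hV'; last first.
      have hs : sub k.+1 V (nseq M 0%N) \in words k.+1 N by apply: sub_words (tmpl_words tV) wM.
      by have /existsP[i] := hU _ hs; rewrite none.
    exists i => v /hV'; by case: pickP => // j Sj [->].
  pose T := sub k.+1 U V; have tT : tmpl k.+1 M n0 T by apply: tmpl_comp tU tV.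
  have siT : size (val i :: T) = n0.+1 by rewrite /= (tmpl_size tT).
  exists (sub k (k :: Y') (val i :: T)); split.
  - case/tmplP: tT => wT hT; apply/tmplP; split.
      apply: (sub_words _ wkY); first by rewrite addSn leqW ?leq_addr.
      apply: words_cons => //; rewrite addSn ltnS.
      exact: ltnW (leq_trans (ltn_ord i) (leq_addr _ _)).
    by move=> j /hT jT; apply: (mem_sub tkY siT); rewrite inE jT orbT.
  - apply: (mem_sub tkY siT); rewrite inE; apply/orP; right.
    by apply/mapP; exists k => //; rewrite ltnSn.
  - move=> v hv; rewrite (sub_sub _ _ wkY) //.
    rewrite (_ : sub k.+1 (val i :: T) v = val i :: sub k.+1 U (sub k.+1 V v)); first exact: hi.
    rewrite /= ltnS (ltnW (ltn_ord i)); congr (_ :: _).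
    by apply: (sub_sub _ _ (tmpl_words tU)) => //; apply: tmpl_size tV.
move=> [U tU hU]; right; have wU := tmpl_words tU.
(* A line of this subspace starts either with the wildcard, and is bad by [bad], or with a constant
   letter, and is bad by [hU]. *)
pose V := k :: shift k U.
have tV : tmpl k m.+1 n0.+1 V.
  apply: (@tmpl_line_cat k m 1 n0 [:: k] _ _ tU).
  apply/tmplP; split; first by apply: words_cons => //; rewrite addn1.
  by case=> // _; rewrite addn0 mem_head.
exists (sub k (k :: Y') V); first exact: tmpl_comp tV.
move=> w /words_consE[a [w' [-> ak hw']]] kw.
rewrite (sub_sub _ _ wkY) ?(tmpl_size tV) //= ltnn subnn /= sub_shift_cons.
have hz : sub k U w' \in words k.+1 n0 by apply: sub_words wU hw'.
move: kw; rewrite inE eq_sym; case: eqP => [->|/eqP nak] /=.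
  by move=> _; have := bad _ hz; rewrite -sub_cons_top /= ltnn subnn.
move=> kw'; apply: contra (hU _ hw' kw') => Sw; apply/existsP.
have ak' : (a < k)%N by rewrite ltn_neqAle nak -ltnS.
by exists (Ordinal ak'); rewrite /= ltnn subnn.
Qed.

(** * The density Hales-Jewett theorem *)

Definition dhj (R : realType) (k d : nat) (delta : R) : Prop :=
  exists N, forall n, (N <= n)%N -> forall A : pred (seq nat),
    delta <= avg k n (fun w => (A w)%:R) ->
    exists2 U, tmpl k d n U & forall z, z \in words k d -> A (sub k U z).

(** By [avg_markov], many y have a section of density at least delta / 2, which contains a line. By
    pigeonhole one line L serves a positive proportion of them, and a subspace of such y is appended
    to L. *)
Lemma dhj_multi (R : realType) k : (0 < k)%N ->
  (forall delta : R, 0 < delta -> dhj k 1 delta) ->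
  forall d (delta : R), 0 < delta -> dhj k d delta.
Proof.
move=> k0 H1; elim=> [|d IH] delta d0.
  exists 0%N => n _ A /(lt_le_trans d0) /(avg_pred_exists k0)[w hw Aw].
  exists w; first by rewrite /tmpl addn0 hw.
  by move=> z hz; rewrite (sub_id _ hw).
have d2 : 0 < delta / 2 by lra.
have [N1 h1] := H1 _ d2.
have T0 : 0 < (k.+1 ^ N1)%:R :> R by rewrite expn_natr_gt0.
have [N2 h2] := IH (delta / 2 / (k.+1 ^ N1)%:R) (divr_gt0 d2 T0).
exists (N1 + N2)%N => n hn A; have -> : n = (N1 + (n - N1))%N by lia.
set n' := (n - N1)%N; rewrite avg_cat avg_swap => hA.
pose f y : R := avg k N1 (fun x => (A (x ++ y))%:R).
have hf : delta / 2 <= avg k n' (fun y => (delta / 2 <= f y)%R%:R).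
  have := @avg_markov R k n' (delta / 2) f k0 (ltW d2); rewrite /f => hm.
  have {}hm := hm (fun w _ => avg_le k0 (fun v _ => boolr_le1 _ _)).
  rewrite -/f in hA hm; lra.
pose P L y := tmpl k 1 N1 L && all (fun i => A (sub k L [:: i] ++ y)) (iota 0 k).
have [|L hL hPL] := avg_pigeonhole (Ls := words k.+1 N1) (P := P) d2 _ hf.
  move=> y hy /(h1 _ (leqnn _) (fun x => A (x ++ y)))[L tL hL].
  exists L; first by have := tmpl_words tL; rewrite addn1.
  rewrite /P tL; apply/allP => i; rewrite mem_iota add0n => /andP[_ ik].
  by apply: hL; apply: words_cons.
rewrite size_words in hPL.
have n'N : (N2 <= n')%N by rewrite /n'; lia.
have [V tV hV] := h2 n' n'N _ hPL.
have tL : tmpl k 1 N1 L.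
  have /hV : nseq d 0%N \in words k d by apply: words_nseq.
  by case/andP.
exists (L ++ shift k V); first exact: tmpl_line_cat.
move=> z /words_consE[e [z' [-> ek hz']]]; rewrite (sub_line_cat _ _ _ (tmpl_words tL)).
by have /andP[_ /allP] := hV _ hz'; apply; rewrite mem_iota.
Qed.

Lemma dhj_one (R : realType) (delta : R) : 0 < delta -> dhj 1 1 delta.
Proof.
move=> d0; exists 1%N => n n1 A /(lt_le_trans d0) /(avg_pred_exists (ltn0Sn _))[w hw Aw].
exists (nseq n 1%N).
  rewrite /tmpl words_nseq //= mem_nseq eqxx n1 //.
move=> z /words_consE[e [z' [-> e0 _]]]; rewrite /sub map_nseq /=.
rewrite (_ : e = 0)%N; last by lia.
suff <- : w = nseq n 0%N by [].
by case/wordsP: hw => <- h; apply/all_pred1P; apply/allP => a /h; case: a.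
Qed.

(** * Sets insensitive to the replacement of the letter [k] by a letter [j < k] *)

Definition insens (k j n : nat) (E : pred (seq nat)) : Prop :=
  forall w, w \in words k.+1 n -> E w = E (sub k w [:: j]).

Lemma sub1_words k j n w : (j < k)%N -> w \in words k.+1 n -> sub k w [:: j] \in words k n.
Proof.
by move=> jk hw; apply: (@sub_words k k 1); rewrite ?addn1 //; apply: words_cons.
Qed.

Lemma sub1_idem k j n w : (j < k)%N -> w \in words k.+1 n ->
  sub k (sub k w [:: j]) [:: j] = sub k w [:: j].
Proof. by move=> jk /(sub1_words jk) hw; rewrite (sub_id _ hw). Qed.

(** The outer substitution replaces every letter [k], whether it comes from U or from z, so
    replacing those of z beforehand changes nothing. *)
Lemma sub1_tmpl k j d n U z : (j < k)%N -> U \in words (k.+1 + d) n -> z \in words k.+1 d ->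
  sub k (sub k.+1 U (sub k z [:: j])) [:: j] = sub k (sub k.+1 U z) [:: j].
Proof.
move=> jk /wordsP[_ hU] hz; rewrite /sub -!map_comp; apply/eq_in_map => c /hU hc /=.
case: (ltnP c k.+1) => // kc.
rewrite (nth_map 0%N); last by rewrite (words_size hz); lia.
case: (ltnP (nth 0%N z (c - k.+1)) k) => [->//|kn].
have := words_nth hz (_ : c - k.+1 < d)%N; rewrite ltnS => /(_ ltac:(lia)) nk.
by rewrite (_ : nth _ _ _ - k = 0)%N ?jk //; lia.
Qed.

Lemma insens_catl k j m n E x : (j < k)%N -> insens k j (m + n) E -> x \in words k.+1 m ->
  insens k j n (fun y => E (x ++ y)).
Proof.
move=> jk hE hx y hy.
have hy' : sub k y [:: j] \in words k.+1 n by apply: words_widen (sub1_words jk hy).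
rewrite hE ?words_cat // [RHS]hE ?words_cat // !sub_cat.
by rewrite (sub1_idem jk hy).
Qed.

Lemma insens_catr k j m n E y : (j < k)%N -> insens k j (m + n) E -> y \in words k.+1 n ->
  insens k j m (fun x => E (x ++ y)).
Proof.
move=> jk hE hy x hx.
have hx' : sub k x [:: j] \in words k.+1 m by apply: words_widen (sub1_words jk hx).
rewrite hE ?words_cat // [RHS]hE ?words_cat // !sub_cat.
by rewrite (sub1_idem jk hx).
Qed.

Lemma insens_tmpl k j d n E U : (j < k)%N -> insens k j n E -> tmpl k.+1 d n U ->
  insens k j d (fun z => E (sub k.+1 U z)).
Proof.
move=> jk hE /tmpl_words tU z hz.
have hz' : sub k z [:: j] \in words k.+1 d by apply: words_widen (sub1_words jk hz).
rewrite hE ?(sub_words _ tU) // [RHS]hE ?(sub_words _ tU) //.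
by rewrite (sub1_tmpl jk tU hz).
Qed.

Lemma geometric_small (R : realType) (c eta : R) : 0 < c -> c <= 1 -> 0 < eta ->
  exists t, (1 - c) ^+ t <= eta.
Proof.
move=> c0 c1 e0.
(* A form of Bernoulli's inequality. *)
have B t : (1 - c) ^+ t * (1 + t%:R * c) <= 1.
  elim: t => [|t IH]; first by rewrite expr0 mul0r addr0 mulr1.
  apply: le_trans IH; rewrite exprSr -mulrA ler_wpM2l ?exprn_ge0 //; first by lra.
  by rewrite -natr1; have : 0 <= t%:R :> R by []; nra.
have ec : 0 <= (eta * c)^-1 by rewrite invr_ge0 mulr_ge0 ?ltW.
exists (Num.bound (eta * c)^-1); set t := Num.bound _.
have tb : (eta * c)^-1 < t%:R := archi_boundP ec.
have : 1 < t%:R * (eta * c) by rewrite -ltr_pdivrMr ?mulr_gt0 // div1r.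
have := B t; set q := (1 - c) ^+ t.
have q0 : 0 <= q by rewrite exprn_ge0; lra.
case: (leP q eta) => // qe; nra.
Qed.

Lemma avg0 (R : realType) k (f : seq nat -> R) : avg k 0 f = f [::].
Proof. by rewrite /avg big_seq1 expn0 divr1. Qed.

Lemma sum_words1 (R : realType) k (f : seq nat -> R) :
  \sum_(w <- words k 1) f w = \sum_(a <- iota 0 k) f [:: a].
Proof. by rewrite big_allpairs_dep; apply: eq_bigr => a _; rewrite big_seq1. Qed.

Lemma avg1S (R : realType) k (f : seq nat -> R) : (0 < k)%N ->
  avg k.+1 1 f = (k.+1%:R)^-1 * f [:: k] + k%:R / k.+1%:R * avg k 1 f.
Proof.
move=> k0; rewrite /avg !sum_words1 -addn1 iotaD big_cat big_seq1 /= !expn1 add0n.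
have kn : k%:R != 0 :> R by rewrite pnatr_eq0 -lt0n.
have kn' : (k + 1)%:R != 0 :> R by rewrite pnatr_eq0 addn1.
by move: kn kn'; move: (_%:R) (_%:R) => a b a0 b0; field; rewrite a0 b0.
Qed.

(* Conditionally on the positions of the letter k, the other letters of a random
   word over k.+1 letters are uniform among the first k, and there are many of them. *)
Lemma avg_mixture (R : realType) k m (eta : R) : (0 < k)%N -> 0 < eta ->
  exists N, forall n, (N <= n)%N -> forall (f : seq nat -> R) (s : R),
    (forall w, f w <= 1) -> 0 <= s ->
    (forall P, tmpl k.+1 m n P -> avg k m (fun z => f (sub k.+1 P z)) <= s) ->
    avg k.+1 n f <= eta + s.
Proof.
move=> k0; elim: m eta => [|m IH] eta e0.
  exists 0%N => n _ f s f1 s0 h.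
  suff : avg k.+1 n f <= s by lra.
  apply: avg_le => // w hw; have := h w; rewrite /tmpl addn0 hw avg0 (sub_id _ hw).
  by apply.
have e2 : 0 < eta / 2 by lra.
have [N hN] := IH _ e2.
have kS : 0 < k.+1%:R :> R by [].
have kk : 0 < k%:R :> R by rewrite ltr0n.
have kSk : k.+1%:R = k%:R + 1 :> R by rewrite natr1.
pose q : R := k.+1%:R^-1; pose p : R := k%:R / k.+1%:R.
have pq : 1 - p = q by rewrite /p /q kSk; field; lra.
have q0 : 0 < q by rewrite invr_gt0.
have p0 : 0 < p by rewrite divr_gt0.
have [a ha] : exists t, (1 - p) ^+ t <= eta / 2 by apply: geometric_small => //; lra.
(* Only the first b letters are inspected. They are all [k] with probability [q ^+ b]; otherwise the
   first letter below [k] is uniform and becomes a variable, which leaves m variables to find. *)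
suff claim b n : (b + N <= n)%N -> forall (f : seq nat -> R) s, (forall w, f w <= 1) ->
    0 <= s ->
    (forall P, tmpl k.+1 m.+1 n P -> avg k m.+1 (fun z => f (sub k.+1 P z)) <= s) ->
    avg k.+1 n f <= q ^+ b + eta / 2 + s.
  exists (a + N)%N => n hn f s f1 s0 h; have := claim _ _ hn f s f1 s0 h.
  by move: ha; rewrite pq; lra.
elim: b n => [|b IHb] n hn f s f1 s0 h.
  by have : avg k.+1 n f <= 1 by [apply: avg_le]; rewrite expr0; lra.
case: n hn h => [//|n] hn h.
rewrite -[n.+1]add1n avg_cat avg1S // -/q -/p.
have h1 : avg k.+1 n (fun y => f ([:: k] ++ y)) <= q ^+ b + eta / 2 + s.
  apply: IHb => //.
  move=> P tP.
  have tkP : tmpl k.+1 m.+1 n.+1 ([:: k] ++ P).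
    by apply: (@tmpl_prefix k.+1 m.+1 1 n) => //; apply: words_cons.
  by have := h _ tkP; under eq_avg => z _ do rewrite sub_cat /= ltnSn.
have h2 : avg k 1 (fun x => avg k.+1 n (fun y => f (x ++ y))) <= eta / 2 + s.
  rewrite avg_swap; apply: hN => //; first exact: leq_trans (leq_addl b N) hn.
    by move=> w; apply: avg_le.
  move=> P tP.
  have tkP : tmpl k.+1 m.+1 n.+1 ([:: k.+1] ++ shift k.+1 P).
    apply: (@tmpl_line_cat k.+1 m 1 n) => //.
    apply/tmplP; split; first by apply: words_cons => //; rewrite addn1.
    by case=> // _; rewrite addn0 mem_head.
  have := h _ tkP; rewrite -[m.+1]add1n avg_cat avg_swap.
  under eq_avg => x hx.
    under eq_avg => y hy.
      have -> : sub k.+1 ([:: k.+1] ++ shift k.+1 P) (y ++ x) = y ++ sub k.+1 P x.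
        case/words_consE: hy => e [y' [-> _ /wordsP[/size0nil -> _]]] /=.
        by rewrite ltnn subnn sub_shift_cons.
    over.
  over.
  by [].
rewrite exprS; move: h1 h2; set u := avg _ _ _; set v := avg _ _ _ => h1 h2.
have : q * u <= q * (q ^+ b + eta / 2 + s) by rewrite ler_pM2l.
have : p * v <= p * (eta / 2 + s) by rewrite ler_pM2l.
have -> : p = 1 - q by lra.
lra.
Qed.

(** [avg_mixture] yields a template P on which E is dense among the words over k letters, where the
    theorem for k letters applies. The resulting subspace extends to k.+1 letters because E does not
    distinguish z from z with [k] replaced by [j]. *)
Lemma insens_contains_tmpl (R : realType) k j d (eta : R) : (j < k)%N ->
  (forall d (delta : R), 0 < delta -> dhj k d delta) -> 0 < eta ->
  exists N, forall n, (N <= n)%N -> forall E, insens k j n E ->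
    eta <= avg k.+1 n (fun w => (E w)%:R) ->
    exists2 U, tmpl k.+1 d n U & forall z, z \in words k.+1 d -> E (sub k.+1 U z).
Proof.
move=> jk H e0; have k0 : (0 < k)%N by lia.
have e2 : 0 < eta / 2 by lra.
have e3 : 0 < eta / 3 by lra.
have [m hm] := H d _ e2; have [N hN] := avg_mixture m k0 e3.
exists N => n hn E hE hE'.
have [P tP hP] : exists2 P, tmpl k.+1 m n P &
    eta / 2 <= avg k m (fun z => (E (sub k.+1 P z))%:R).
  apply: contrapT => nP.
  suff : avg k.+1 n (fun w => (E w)%:R : R) <= eta / 3 + eta / 2 by lra.
  apply: hN => // [w||]; [exact: boolr_le1|exact: ltW|].
  move=> P tP; rewrite leNgt; apply/negP => /ltW hP.
  by apply: nP; exists P.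
have [V tV hV] := hm m (leqnn _) (fun z => E (sub k.+1 P z)) hP.
have tsV := tmpl_shift tV; have wP := tmpl_words tP.
have tU := tmpl_comp tP tsV; exists (sub k.+1 P (shift k V)) => // z hz.
have hz' : sub k z [:: j] \in words k d := sub1_words jk hz.
rewrite (insens_tmpl jk hE tU hz) (sub_sub _ _ wP) ?(tmpl_size tsV) // sub_shift.
exact: hV.
Qed.

(* Greedy partition: cut off m letters at a time and remove from E a product of a
   fixed subspace of dimension d with the insensitive set Y of those y for which the
   subspace lies in the section of E at y. *)
Lemma insens_avg_le (R : realType) k j d (eta : R) : (j < k)%N ->
  (forall d (delta : R), 0 < delta -> dhj k d delta) -> 0 < eta ->
  exists N, forall n, (N <= n)%N -> forall (f : seq nat -> R) (E : pred (seq nat)),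
    (forall w, f w <= 1) -> insens k j n E ->
    (forall U, tmpl k.+1 d n U -> avg k.+1 d (fun z => f (sub k.+1 U z)) <= 0) ->
    avg k.+1 n (fun w => (E w)%:R * f w) <= eta.
Proof.
move=> jk H e0.
have [e' e'0 etaE] : exists2 e' : R, 0 < e' & eta = 4 * e'.
  by exists (eta / 4); lra.
have [e e_gt0 eE] : exists2 e : R, 0 < e & e = 2 * e' by exists (2 * e'); lra.
have [m hm] := insens_contains_tmpl d jk H e'0.
(* [kap] is the density of a subspace in a block of m letters and [th] bounds the density of Y below
   for a suitable V, so a round removes at least c from the density of E. *)
have [kap kap0 kapE] : exists2 x : R, 0 < x & (k.+1 ^ d)%:R / (k.+1 ^ m)%:R = x.
  by eexists; last by []; rewrite divr_gt0 ?expn_natr_gt0.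
have [th th0 thE] : exists2 x : R, 0 < x & e' / ((k.+1 + d) ^ m)%:R = x.
  by eexists; last by []; rewrite divr_gt0 ?expn_natr_gt0.
have [c [c0 c1 ckt]] : exists c : R, [/\ 0 < c, c <= 1 & c <= kap * th].
  exists (Num.min 1 (kap * th)).
  by rewrite lt_min ltr01 mulr_gt0 // !ge_min !lexx orbT.
have [t ht] := geometric_small c0 c1 e_gt0.
have Ef n (f : seq nat -> R) (E : pred (seq nat)) : (forall w, f w <= 1) ->
    avg k.+1 n (fun w => (E w)%:R * f w) <= avg k.+1 n (fun w => (E w)%:R).
  by move=> f1; apply: le_avg => w _; case: (E w); rewrite /= ?mul1r ?mul0r.
(* Each of the s rounds contributes a factor 1 - c; a set of density at most e is not cut any
   further. With s = t the total is at most 2 * e = eta. *)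
suff claim s n : (s * m <= n)%N -> forall (f : seq nat -> R) (E : pred (seq nat)),
    (forall w, f w <= 1) -> insens k j n E ->
    (forall U, tmpl k.+1 d n U -> avg k.+1 d (fun z => f (sub k.+1 U z)) <= 0) ->
    avg k.+1 n (fun w => (E w)%:R * f w)
      <= e + (1 - c) ^+ s * avg k.+1 n (fun w => (E w)%:R).
  exists (t * m)%N => n hn f E f1 hE hU; apply: le_trans (claim _ _ hn f E f1 hE hU) _.
  have a1 : avg k.+1 n (fun w => (E w)%:R : R) <= 1.
    by apply: avg_le => // w _; apply: boolr_le1.
  have : (1 - c) ^+ t * avg k.+1 n (fun w => (E w)%:R) <= (1 - c) ^+ t * 1.
    by rewrite ler_wpM2l // exprn_ge0; lra.
  by lra.
elim: s n => [|s IH] n hn f E f1 hE hU.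
  by rewrite expr0 mul1r; have := Ef n f E f1; lra.
have [aE aEE] : exists a : R, a = avg k.+1 n (fun w => (E w)%:R) by eexists.
rewrite -aEE.
have aE0 : 0 <= aE by rewrite aEE; apply: avg_ge0.
have aE1 : aE <= 1 by rewrite aEE; apply: avg_le => // w _; apply: boolr_le1.
have c1' : 0 <= 1 - c by lra.
have [q q0 qE] : exists2 q : R, 0 <= q & (1 - c) ^+ s = q.
  by eexists; last by []; rewrite exprn_ge0.
rewrite exprSr qE; case: (leP aE e) => aEe.
  have := Ef n f E f1; rewrite -aEE => /le_trans; apply; apply: (le_trans aEe).
  by rewrite lerDl !mulr_ge0.
have [n' hn' en] : exists2 n', (s * m <= n')%N & n = (m + n')%N.
  have mn : (m <= n)%N by apply: leq_trans hn; rewrite mulSn leq_addr.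
  by exists (n - m)%N; [rewrite leq_subRL // -mulSn|rewrite subnKC].
subst n.
pose g y : R := avg k.+1 m (fun x => (E (x ++ y))%:R).
have hg : e' <= avg k.+1 n' (fun y => (e' <= g y)%R%:R).
  have := @avg_markov R k.+1 n' e' g isT (ltW e'0) (fun y _ => avg_le _ (fun x _ => boolr_le1 _ _)).
  have -> : avg k.+1 n' g = aE by rewrite aEE avg_cat avg_swap.
  by move=> /(_ isT); lra.
pose Y V y := all (fun z => E (sub k.+1 V z ++ y)) (words k.+1 d).
have [|V _ hV] := avg_pigeonhole (Ls := words (k.+1 + d) m)
  (P := fun V y => tmpl k.+1 d m V && Y V y) e'0 _ hg.
  move=> y hy /(hm m (leqnn _) (fun x => E (x ++ y)) (insens_catr jk hE hy))[V tV hV].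
  by exists V; [exact: tmpl_words tV|rewrite tV; apply/allP].
rewrite size_words thE in hV.
have [y0 _ /andP[tV _]] := avg_pred_exists (ltn0Sn k) (lt_le_trans th0 hV).
rewrite tV /= in hV.
have wV := tmpl_words tV.
pose I x := x \in [seq sub k.+1 V z | z <- words k.+1 d].
(* What remains of E. Its section at each x is still insensitive, so the induction hypothesis
   applies to it. *)
pose E' x y := E (x ++ y) && ~~ (I x && Y V y).
have splitE x y : (E (x ++ y))%:R = (E' x y)%:R + (I x)%:R * (Y V y)%:R :> R.
  rewrite /E'; case Ix: (I x); case Yy: (Y V y); rewrite ?andbT ?andbF /= ?mulr0 ?mul0r ?addr0 //.
  move/mapP: Ix => [z hz ->]; move/allP: Yy => /(_ _ hz) ->.
  by rewrite /= mulr1 add0r.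
have insE' x : x \in words k.+1 m -> insens k j n' (E' x).
  move=> hx y hy; rewrite /E' (insens_catl jk hE hx hy); congr (_ && ~~ (_ && _)).
  apply: eq_in_all => z hz.
  have hVz : sub k.+1 V z \in words k.+1 m by apply: (sub_words _ wV).
  exact: insens_catl jk hE hVz _ hy.
pose aY := avg k.+1 n' (fun y => (Y V y)%:R : R).
have aEsplit : aE = avg k.+1 m (fun x => avg k.+1 n' (fun y => (E' x y)%:R)) + kap * aY.
  rewrite aEE avg_cat.
  under eq_avg => x _ do (under eq_avg => y _ do rewrite splitE); rewrite /=.
  under eq_avg => x _ do rewrite avgD avgZ.
  by rewrite avgD (avg_image _ (ltn0Sn k) tV) avg_cst // kapE.
have step1 : avg k.+1 (m + n') (fun w => (E w)%:R * f w) <=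
    avg k.+1 m (fun x => avg k.+1 n' (fun y => (E' x y)%:R * f (x ++ y))).
  rewrite avg_cat.
  under eq_avg => x _ do (under eq_avg => y _ do rewrite splitE mulrDl); rewrite /=.
  under eq_avg => x _ do rewrite avgD.
  (* The removed part is a union of subspaces [V ++ y], on each of which f has average at most 0. *)
  rewrite avgD gerDl avg_swap; apply: avg_le => // y hy.
  have -> : avg k.+1 m (fun x => (I x)%:R * (Y V y)%:R * f (x ++ y))
      = (Y V y)%:R * avg k.+1 m (fun x => (I x)%:R * f (x ++ y)).
    by rewrite -avgZ; apply: eq_avg => x _; ring.
  rewrite (avg_image (fun x => f (x ++ y)) (ltn0Sn k) tV) kapE.
  have := hU _ (tmpl_suffix hy tV).
  have -> : avg k.+1 d (fun z => f (sub k.+1 (V ++ y) z))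
      = avg k.+1 d (fun z => f (sub k.+1 V z ++ y)).
    by apply: eq_avg => z _; rewrite sub_cat (sub_id _ hy).
  move=> av; rewrite mulr_ge0_le0 // mulr_ge0_le0 //; exact: ltW.
have step2 : avg k.+1 m (fun x => avg k.+1 n' (fun y => (E' x y)%:R * f (x ++ y))) <=
    avg k.+1 m (fun x => e + q * avg k.+1 n' (fun y => (E' x y)%:R)).
  apply: le_avg => x hx; rewrite -qE; apply: (IH _ hn' (fun y => f (x ++ y))) => //.
    exact: insE'.
  move=> U tU; have := hU _ (tmpl_prefix hx tU).
  have -> // : avg k.+1 d (fun z => f (sub k.+1 (x ++ U) z))
      = avg k.+1 d (fun z => f (x ++ sub k.+1 U z)).
  by apply: eq_avg => z _; rewrite sub_cat (sub_id _ hx).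
apply: le_trans step1 (le_trans step2 _).
rewrite avgD avg_cst // avgZ lerD2l -mulrA ler_wpM2l //.
(* The removed density is at least c, hence at least [c * aE] since [aE <= 1]. *)
have : kap * th <= kap * aY by rewrite ler_pM2l.
move: aEsplit; move: (avg k.+1 m _) => aE' aEsplit; nra.
Qed.

(** Induction on i: [insens_avg_le] is applied to [E i] and to f times the indicator of the earlier
    sets, minus eta / 2. By the induction hypothesis this function has average at most 0 on
    subspaces of dimension [d']. *)
Lemma insens_inter_avg_le (R : realType) k i d (eta : R) : (i <= k)%N ->
  (forall d (delta : R), 0 < delta -> dhj k d delta) -> 0 < eta ->
  exists N, forall n, (N <= n)%N -> forall (f : seq nat -> R) (E : nat -> pred (seq nat)),
    (forall w, f w <= 1) -> (forall j, (j < i)%N -> insens k j n (E j)) ->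
    (forall U, tmpl k.+1 d n U -> avg k.+1 d (fun z => f (sub k.+1 U z)) <= 0) ->
    avg k.+1 n (fun w => (all (fun j => E j w) (iota 0 i))%:R * f w) <= eta.
Proof.
move=> ik H; elim: i ik eta => [|i IH] ik eta e0.
  exists d => n dn f E f1 _ hU; apply: le_trans (ltW e0).
  under eq_avg => w _ do rewrite /= mul1r.
  rewrite -(subnK dn) avg_cat; apply: avg_le => // x hx.
  have := hU (x ++ iota k.+1 d); rewrite -{1}(subnK dn).
  move=> /(_ (tmpl_prefix hx (tmpl_vars _ _))); congr (_ <= _); apply: eq_avg => z hz.
  by rewrite sub_cat (sub_id _ hx) sub_vars // (words_size hz).
have e2 : 0 < eta / 2 by lra.
have [d' hd'] := IH (ltnW ik) _ e2; have [N hN] := insens_avg_le d' ik H e2.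
exists N => n hn f E f1 hE hU.
pose b w := all (fun j => E j w) (iota 0 i).
have -> : avg k.+1 n (fun w => (all (fun j => E j w) (iota 0 i.+1))%:R * f w)
  = avg k.+1 n (fun w => (E i w)%:R * ((b w)%:R * f w - eta / 2))
    + eta / 2 * avg k.+1 n (fun w => (E i w)%:R).
  rewrite -avgZ -avgD; apply: eq_avg => w _.
  rewrite -addn1 iotaD all_cat /= andbT add0n -/(b w) -mulnb natrM.
  by move: (_%:R : R) (_%:R : R) (f w) => x y z; field.
have h1 : avg k.+1 n (fun w => (E i w)%:R : R) <= 1.
  by apply: avg_le => // w _; apply: boolr_le1.
suff h2 : avg k.+1 n (fun w => (E i w)%:R * ((b w)%:R * f w - eta / 2)) <= eta / 2.
  have : eta / 2 * avg k.+1 n (fun w => (E i w)%:R : R) <= eta / 2 by rewrite ger_pMr.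
  lra.
apply: hN => //; [|exact: hE|].
  by move=> w; have := f1 w; case: (b w); rewrite /= ?mul1r ?mul0r; lra.
move=> U tU; rewrite avgB avg_cst // subr_le0.
apply: (hd' d' (leqnn _) (fun z => f (sub k.+1 U z)) (fun j z => E j (sub k.+1 U z))) => //.
  move=> j ji; apply: insens_tmpl (hE j _) tU; last exact: ltnW.
  exact: leq_trans ji (ltnW ik).
move=> V tV; have := hU _ (tmpl_comp tU tV); congr (_ <= _); apply: eq_avg => z hz.
by rewrite (sub_sub _ _ (tmpl_words tU)) // (tmpl_size tV).
Qed.

(** * Density increment for line-free sets *)

Definition has_line (k n : nat) (A : pred (seq nat)) : Prop :=
  exists2 U, tmpl k 1 n U & forall z, z \in words k 1 -> A (sub k U z).

(** The deficits [u - a w] are nonnegative, so their sum, at most [k ^ m * (u - l)], bounds each of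
    them. *)
Lemma avg_lower (R : realType) k m (a : seq nat -> R) (u l : R) x : (0 < k)%N ->
  (forall w, w \in words k m -> a w <= u) -> l <= avg k m a -> x \in words k m ->
  u - (k ^ m)%:R * (u - l) <= a x.
Proof.
move=> k0 hu hl hx.
have : u - a x <= \sum_(w <- words k m) (u - a w).
  rewrite (big_rem x) //= lerDl big_seq sumr_ge0 // => w /mem_rem /hu.
  by rewrite subr_ge0.
have -> : \sum_(w <- words k m) (u - a w) = (k ^ m)%:R * (u - avg k m a).
  rewrite -[u in RHS](avg_cst m u k0) -avgB /avg mulrC divfK //.
  by rewrite gt_eqF // expn_natr_gt0.
have : (k ^ m)%:R * (u - avg k m a) <= (k ^ m)%:R * (u - l).
  by rewrite ler_wpM2l // lerD2l lerN2.
lra.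
Qed.

Lemma no_line_tmpl (R : realType) k N d n (delta : R) A W :
  (forall n, (N <= n)%N -> forall A : pred (seq nat),
    delta <= avg k n (fun w => (A w)%:R) -> has_line k n A) ->
  ~ has_line k n A -> (N <= d)%N -> tmpl k d n W ->
  avg k d (fun z => (A (sub k W z))%:R) <= delta.
Proof.
move=> hN nA Nd tW; rewrite leNgt; apply/negP => /ltW.
move=> /(hN _ Nd (fun z => A (sub k W z)))[L tL hL]; apply: nA.
exists (sub k W L); first exact: tmpl_comp tL.
by move=> z /hL; rewrite (sub_sub _ _ (tmpl_words tW)) // (tmpl_size tL).
Qed.

(** Markov and pigeonhole over the candidate lines of U, as in [dhj_multi]. The conclusion will
    refute the second alternative of [line_dichotomy]. *)
Lemma has_good_line (R : realType) k m0 m n (delta : R) (A : pred (seq nat)) U :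
  (0 < k)%N -> 0 < delta ->
  (forall B : pred (seq nat),
    delta / 2 <= avg k m0 (fun w => (B w)%:R) -> has_line k m0 B) ->
  tmpl k m0 m U ->
  (forall x, x \in words k m ->
    delta / 2 + delta / 4 <= avg k.+1 n (fun y => (A (x ++ y))%:R)) ->
  exists L, [/\ L \in words k.+1 m0, k \in L &
    delta / 4 / (k.+1 ^ m0)%:R <= avg k.+1 n (fun y =>
      (all (fun i => A (sub k (sub k U L) [:: i] ++ y)) (iota 0 k))%:R)].
Proof.
move=> k0 d0 hm0 tU hA; have wU := tmpl_words tU.
have d2 : 0 <= delta / 2 by lra.
have d4 : 0 < delta / 4 by lra.
pose g y : R := avg k m0 (fun u => (A (sub k U u ++ y))%:R).
have hg : delta / 4 <= avg k.+1 n (fun y => (delta / 2 <= g y)%R%:R).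
  have := @avg_markov R k.+1 n _ g isT d2 (fun y _ => avg_le k0 (fun x _ => boolr_le1 _ _)).
  have : delta / 2 + delta / 4 <= avg k.+1 n g.
    rewrite /g -avg_swap; apply: avg_ge => // u hu; apply: hA.
    exact: sub_words wU hu.
  lra.
pose P L y := tmpl k 1 m0 L && all (fun i => A (sub k (sub k U L) [:: i] ++ y)) (iota 0 k).
have [|L hL hPL] := avg_pigeonhole (Ls := words k.+1 m0) (P := P) d4 _ hg.
  move=> y hy /(hm0 (fun u => A (sub k U u ++ y)))[L tL hL].
  exists L; first by have := tmpl_words tL; rewrite addn1.
  rewrite /P tL; apply/allP => i; rewrite mem_iota add0n => /andP[_ ik].
  rewrite (sub_sub _ _ wU) ?(tmpl_size tL) //.
  by apply: hL; apply: words_cons.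
rewrite size_words in hPL; exists L; split=> //.
  have /(avg_pred_exists (ltn0Sn k))[y _ /andP[/tmplP[_ h] _]] :
      0 < avg k.+1 n (fun y => (P L y)%:R : R).
    by apply: lt_le_trans hPL; rewrite divr_gt0 ?expn_natr_gt0.
  by have := h 0%N isT; rewrite addn0.
apply: le_trans hPL _; apply: le_avg => y _; rewrite /P ler_nat.
by case: (tmpl _ _ _ _).
Qed.

(** Sorts the failures by the first index that fails. *)
Lemma natr_not_all (R : realType) k (P : pred nat) :
  (~~ all P (iota 0 k))%:R = \sum_(i <- iota 0 k) (all P (iota 0 i) && ~~ P i)%:R :> R.
Proof.
elim: k => [|k IH]; first by rewrite big_nil.
rewrite -addn1 iotaD big_cat -IH big_seq1 /= add0n all_cat /= andbT.
by case: (all _ _); case: (P k); rewrite /= ?addr0 ?add0r.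
Qed.

(** Writes a first failure at i as an intersection over all of [iota 0 k], the form treated by
    [insens_inter_avg_le]. *)
Lemma all_iota_prefix k i (P : pred nat) : (i < k)%N ->
  all (fun j => if (j < i)%N then P j else if j == i then ~~ P j else true) (iota 0 k)
  = all P (iota 0 i) && ~~ P i.
Proof.
move=> ik; apply/allP/andP => [h|[/allP h Pi] j _].
  split; last by have := h i; rewrite mem_iota ltnn eqxx => /(_ ik).
  apply/allP => j; rewrite mem_iota add0n => /andP[_ ji].
  by have := h j; rewrite mem_iota ji add0n => /(_ (ltn_trans ji ik)).
case: (ltnP j i) => ji; last by case: eqP => // ->.
by apply: h; rewrite mem_iota.
Qed.

(** The letter [k] of w is turned into the wildcard [k.+1]: the points at i < k are in A by
    hypothesis, and the point at [k] is w itself. *)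
Lemma has_line_top k m n (A : pred (seq nat)) w y :
  w \in words k.+1 m -> k \in w -> y \in words k.+1 n ->
  all (fun i => A (sub k w [:: i] ++ y)) (iota 0 k) -> A (w ++ y) -> has_line k.+1 (m + n) A.
Proof.
move=> hw kw hy /allP hA Aw.
have hw1 : w \in words (k + 1) m by rewrite addn1.
exists (sub k w [:: k.+1] ++ y).
  apply: tmpl_suffix hy _; apply/tmplP; split.
    by apply: (sub_words _ hw1); [lia|apply: words_cons => //; lia].
  case=> // _; rewrite addn0; apply/mapP; exists k => //.
  by rewrite ltnn subnn.
move=> z /words_consE[e [z' [-> ek /wordsP[/size0nil -> _]]]].
rewrite sub_cat (sub_id _ hy) (sub_sub _ _ hw1) // (_ : sub k.+1 _ _ = [:: e]); last first.
  by rewrite /= ltnn subnn.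
case: (ltnP e k) => [ek'|ke]; first by apply: hA; rewrite mem_iota.
have -> : e = k by lia.
rewrite (_ : sub k w [:: k] = w) //.
rewrite /sub -[RHS]map_id; apply/eq_in_map => c; case/wordsP: hw => _ h /h.
by case: (ltnP c k) => // kc ck; have -> : c = k by [lia]; rewrite subnn.
Qed.

(** The function [a - c] has average at most 0 on subspaces. The complement of the intersection of
    the [D i] splits into k intersections of insensitive sets, so it contributes at most [k * eta];
    on the intersection itself a vanishes, which gains c times its density. *)
Lemma avg_le_insens_avoid (R : realType) k d M (eta c : R) (a : pred (seq nat))
    (D : nat -> pred (seq nat)) : 0 <= c ->
  (forall (f : seq nat -> R) (E : nat -> pred (seq nat)),
    (forall w, f w <= 1) -> (forall j, (j < k)%N -> insens k j M (E j)) ->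
    (forall U, tmpl k.+1 d M U -> avg k.+1 d (fun z => f (sub k.+1 U z)) <= 0) ->
    avg k.+1 M (fun w => (all (fun j => E j w) (iota 0 k))%:R * f w) <= eta) ->
  (forall i, (i < k)%N -> insens k i M (D i)) ->
  (forall U, tmpl k.+1 d M U -> avg k.+1 d (fun z => (a (sub k.+1 U z))%:R) <= c) ->
  (forall v, v \in words k.+1 M -> all (fun i => D i v) (iota 0 k) -> ~~ a v) ->
  avg k.+1 M (fun v => (a v)%:R) <=
    k%:R * eta + c - c * avg k.+1 M (fun v => (all (fun i => D i v) (iota 0 k))%:R).
Proof.
move=> c0 hM hD hU hDa.
pose f v : R := (a v)%:R - c.
have f1 v : f v <= 1 by rewrite /f; have := boolr_le1 R (a v); lra.
have h1 : avg k.+1 M (fun v => (~~ all (fun i => D i v) (iota 0 k))%:R * f v) <= k%:R * eta.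
  under eq_avg => v _ do rewrite natr_not_all mulr_suml.
  have -> : k%:R * eta = \sum_(i <- iota 0 k) eta.
    by rewrite big_const_seq count_predT size_iota iter_addr_0 mulr_natl.
  rewrite avg_sum big_seq [leRHS]big_seq; apply: ler_sum => i.
  rewrite mem_iota add0n => /andP[_ ik].
  pose E j v := if (j < i)%N then D j v else if j == i then ~~ D j v else true.
  rewrite (_ : avg _ _ _ = avg k.+1 M (fun w => (all (fun j => E j w) (iota 0 k))%:R * f w)).
    apply: hM => // [j jk w hw|U tU].
      by rewrite /E; case: ltnP => _; [|case: eqP => // _]; rewrite (hD j jk w hw).
    by rewrite avgB avg_cst // subr_le0; apply: hU.
  by apply: eq_avg => v _; rewrite /E (all_iota_prefix (fun j => D j v) ik).
have h2 : avg k.+1 M (fun v => (~~ all (fun i => D i v) (iota 0 k))%:R * f v)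
    = avg k.+1 M (fun v => (a v)%:R) - c
      + c * avg k.+1 M (fun v => (all (fun i => D i v) (iota 0 k))%:R).
  rewrite -avgZ -[X in _ - X](avg_cst M c (ltn0Sn k)) -avgB -avgD.
  apply: eq_avg => v /hDa; rewrite /f; case: (all _ _) => /=.
    by move=> /(_ isT)/negbTE -> /=; rewrite mul0r sub0r mulr1 addrC subrr.
  by rewrite mul1r mulr0 addr0.
by rewrite h2 in h1; lra.
Qed.

(** For fixed y, the v for which the i-th point of the line lies in A form an insensitive set, and
    by [has_line_top] a line-free A avoids the intersection of these sets. The resulting bound is
    averaged over y. *)
Lemma no_line_bound (R : realType) k d m M n (alpha theta eta c : R) (A : pred (seq nat)) U :
  0 <= c ->
  (forall (f : seq nat -> R) (E : nat -> pred (seq nat)),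
    (forall w, f w <= 1) -> (forall j, (j < k)%N -> insens k j M (E j)) ->
    (forall U, tmpl k.+1 d M U -> avg k.+1 d (fun z => f (sub k.+1 U z)) <= 0) ->
    avg k.+1 M (fun w => (all (fun j => E j w) (iota 0 k))%:R * f w) <= eta) ->
  ~ has_line k.+1 (m + n) A ->
  (forall W, tmpl k.+1 d (m + n) W -> avg k.+1 d (fun z => (A (sub k.+1 W z))%:R) <= c) ->
  (forall x, x \in words k.+1 m -> alpha <= avg k.+1 n (fun y => (A (x ++ y))%:R)) ->
  tmpl k.+1 M m U -> k \in U ->
  (forall v, v \in words k.+1 M -> theta <= avg k.+1 n (fun y =>
      (all (fun i => A (sub k (sub k.+1 U v) [:: i] ++ y)) (iota 0 k))%:R)) ->
  alpha <= k%:R * eta + c - c * theta.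
Proof.
move=> c0 hM nA hc ha tU kU hU; have wU := tmpl_words tU.
have wUv v : v \in words k.+1 M -> sub k.+1 U v \in words k.+1 m by apply: sub_words wU.
have h1 y : y \in words k.+1 n -> avg k.+1 M (fun v => (A (sub k.+1 U v ++ y))%:R) <=
    k%:R * eta + c - c * avg k.+1 M (fun v =>
      (all (fun i => A (sub k (sub k.+1 U v) [:: i] ++ y)) (iota 0 k))%:R).
  move=> hy; apply: (avg_le_insens_avoid (d := d) (a := fun v => A (sub k.+1 U v ++ y))
    (D := fun i v => A (sub k (sub k.+1 U v) [:: i] ++ y)) c0 hM).
  - by move=> i ik v hv /=; rewrite (sub1_tmpl ik wU hv).
  - move=> V tV; have := hc _ (tmpl_suffix hy (tmpl_comp tU tV)); congr (_ <= _).
    apply: eq_avg => z _; rewrite sub_cat (sub_id _ hy) (sub_sub _ _ wU) //.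
    exact: tmpl_size tV.
  - move=> v hv hD; apply/negP => Av; apply: nA.
    apply: has_line_top (wUv _ hv) _ hy hD Av.
    by apply/mapP; exists k => //; rewrite ltnSn.
have h2 : alpha <= avg k.+1 n (fun y => avg k.+1 M (fun v => (A (sub k.+1 U v ++ y))%:R)).
  by rewrite -avg_swap; apply: avg_ge => // v /wUv; apply: ha.
have h3 : theta <= avg k.+1 n (fun y => avg k.+1 M (fun v =>
      (all (fun i => A (sub k (sub k.+1 U v) [:: i] ++ y)) (iota 0 k))%:R)).
  by rewrite -avg_swap; apply: avg_ge.
apply: (le_trans h2); apply: le_trans (le_avg h1) _.
rewrite avgB avg_cst // avgZ lerD2l lerN2.
exact: ler_wpM2l.
Qed.

(** A line-free set of density at least [delta - g] has all its sections of density at least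
    [delta - eps]. [has_good_line] then forces the first alternative of [line_dichotomy], and
    [no_line_bound] gives a contradiction. *)
Lemma dhj_lower (R : realType) k (delta : R) : (0 < k)%N -> 0 < delta ->
  (forall d (delta : R), 0 < delta -> dhj k d delta) ->
  (forall delta' : R, delta < delta' -> dhj k.+1 1 delta') ->
  exists2 delta' : R, delta' < delta & dhj k.+1 1 delta'.
Proof.
move=> k0 d0 H Hd; have d2 : 0 < delta / 2 by lra.
have [m0 hm0] := H 1%N _ d2.
have [th th0 thE] : exists2 th : R, 0 < th & delta / 4 / (k.+1 ^ m0)%:R = th.
  by eexists; last by []; rewrite divr_gt0 ?expn_natr_gt0 //; lra.
(* Chosen so that the final bound [delta - eps <= 2 * b + delta - 8 * b - b * th] contradicts
   [eps <= b]. *)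
have [b b0 bE] : exists2 b : R, 0 < b & delta * th = 8 * b.
  by exists (delta * th / 8); [rewrite divr_gt0 // mulr_gt0|lra].
have k0' : 0 < k%:R :> R by rewrite ltr0n.
have [eta eta0 etaE] : exists2 eta : R, 0 < eta & k%:R * eta = b.
  by exists (b / k%:R); [rewrite divr_gt0|rewrite mulrC divfK // gt_eqF].
have [d hd] := Hd (delta + b) ltac:(lra).
have [M hM] := insens_inter_avg_le d (leqnn k) H eta0.
have [m hm] := line_dichotomy k m0 M.
have [eps [eps0 epsb epsd]] : exists eps : R, [/\ 0 < eps, eps <= b & eps <= delta / 4].
  exists (Num.min b (delta / 4)); rewrite lt_min b0 !ge_min !lexx orbT; split=> //.
  by apply/andP; split=> //; lra.
(* The sections are at most [delta + g] and their average at least [delta - g]; by [avg_lower] no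
   section falls short of [delta + g] by more than eps. *)
have [g g0 gE] : exists2 g : R, 0 < g & (k.+1 ^ m)%:R * (2 * g) = eps.
  exists (eps / (2 * (k.+1 ^ m)%:R)); first by rewrite divr_gt0 // mulr_gt0 ?expn_natr_gt0.
  have : (k.+1 ^ m)%:R != 0 :> R by rewrite gt_eqF // expn_natr_gt0.
  by move: (_%:R : R) => x x0; field.
have [N hN] := Hd (delta + g) ltac:(lra).
exists (delta - g); first by lra.
exists (maxn (m + N) (m + d)) => n; rewrite geq_max => /andP[mN md] A hA.
apply: contrapT; rewrite -/(has_line k.+1 n A) => nA.
have [n' nE] : exists n', n = (m + n')%N.
  by exists (n - m)%N; rewrite subnKC //; apply: leq_trans mN; rewrite leq_addr.
subst n; rewrite !leq_add2l in mN md.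
have hsec x : x \in words k.+1 m ->
    avg k.+1 n' (fun y => (A (x ++ y))%:R) <= delta + g.
  move=> hx; have := no_line_tmpl hN nA mN (tmpl_prefix hx (tmpl_vars _ _)).
  congr (_ <= _); apply: eq_avg => z hz.
  by rewrite sub_cat (sub_id _ hx) sub_vars // (words_size hz).
have hlow x : x \in words k.+1 m ->
    delta - eps <= avg k.+1 n' (fun y => (A (x ++ y))%:R).
  move=> hx; rewrite avg_cat in hA.
  have := avg_lower (ltn0Sn k) hsec hA hx.
  have -> : delta + g - (delta - g) = 2 * g by ring.
  by rewrite gE => h; apply: le_trans h; lra.
case: (hm (fun w => th <= avg k.+1 n' (fun y =>
    (all (fun i => A (sub k w [:: i] ++ y)) (iota 0 k))%:R))).
  move=> [U [tU kU hU]].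
  have := no_line_bound (c := delta + b) _ (hM M (leqnn _)) nA _ hlow tU kU hU.
  rewrite etaE => h.
  have {h} : delta - eps <= b + (delta + b) - (delta + b) * th.
    apply: h => [|W tW]; [by lra|exact: no_line_tmpl hd nA (leqnn d) tW].
  have : 0 < b * th by rewrite mulr_gt0.
  by rewrite mulrDl bE; lra.
move=> [U tU hU].
have [|L [hL kL]] := has_good_line (A := A) (n := n') k0 d0 (hm0 m0 (leqnn _)) tU.
  move=> x hx; apply: le_trans (hlow x _); first by lra.
  exact: words_widen hx.
by rewrite thE; apply/negP; apply: hU.
Qed.

Theorem density_hales_jewett (R : realType) k (delta : R) : 0 < delta -> dhj k.+1 1 delta.
Proof.
elim: k delta => [|k IH] delta d0; first exact: dhj_one.
have H := dhj_multi (ltn0Sn k) IH.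
pose S : set R := [set x | 0 < x /\ dhj k.+2 1 x]%classic.
have S2 : S 2.
  split=> //; exists 0%N => n _ A h; exfalso; move: h; apply/negP; rewrite -ltNge.
  apply: le_lt_trans (_ : 1 < 2); last by lra.
  by apply: avg_le => // w _; apply: boolr_le1.
have lbS : has_inf S.
  by split; [exists 2|exists 0 => x [/ltW]].
have up (x y : R) : x <= y -> dhj k.+2 1 x -> dhj k.+2 1 y.
  by move=> xy [N hN]; exists N => n hn A hA; apply: hN hn _ (le_trans xy hA).
have above (x : R) : inf S < x -> dhj k.+2 1 x.
  by move=> /(inf_lt lbS.1)[y [_ hy] yx]; apply: up (ltW yx) hy.
apply: (above); rewrite ltNge; apply/negP => dS.
have [x xS hx] := dhj_lower (ltn0Sn k) (lt_le_trans d0 dS) H above.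
(* The maximum keeps the new threshold positive, as S demands, and still below [inf S]. *)
have : inf S <= Num.max x (inf S / 2).
  apply: (ge_inf lbS.2); split; last by apply: up hx; rewrite le_max lexx.
  by rewrite lt_max; apply/orP; right; lra.
by rewrite le_max => /orP[]; lra.
Qed.

(** * Progressions in almost invariant sets *)

(** The sum of the letters turns a line into an arithmetic progression, whose difference is the
    number of wildcards. *)
Lemma sumn_sub_line k U i : (forall c, c \in U -> (c < k + 1)%N) ->
  sumn (sub k U [:: i]) = (i * count_mem k U + sumn (sub k U [:: 0%N]))%N.
Proof.
elim: U => [|c U IH] hU; first by rewrite muln0.
rewrite /= -!/(sub _ _ _) IH; last by move=> e eU; apply: hU; rewrite inE eU orbT.
have := hU c (mem_head _ _); case: (ltngtP c k) => [ck|kc|->] h.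
- by rewrite add0n addnCA.
- by lia.
- by rewrite subnn /= mulnDr muln1 add0n addnA.
Qed.

Lemma limn_sup_frequently (R : realType) (u : nat -> R) :
  (forall n, 0 <= u n <= 1) -> 0 < limn_sup u ->
  exists2 delta : R, 0 < delta & forall n, exists2 m, (n <= m)%N & delta < u m.
Proof.
move=> u01.
have ubu : has_ubound (range u) by exists 1 => _ [n _ <-]; case/andP: (u01 n).
have lbu : has_lbound (range u) by exists 0 => _ [n _ <-]; case/andP: (u01 n).
have -> : limn_sup u = inf (range (sups u)).
  by apply: cvg_lim => //; apply: cvg_sups_inf.
set l := inf _ => l0; exists (l / 2); first by lra.
move=> n.
have hl : l <= sups u n.
  apply: ge_inf; last by exists n.
  exists 0 => _ [i _ <-]; have /andP[h _] := u01 i; apply: (le_trans h).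
  apply: ub_le_sup; last by exists i => //=.
  by case: ubu => M hM; exists M => _ [j _ <-]; apply: hM; exists j.
have [] := @sup_gt R (sdrop u n) (l / 2).
- by exists (u n), n => /=.
- by apply: lt_le_trans hl; lra.
- by move=> _ [m nm <-] lm; exists m.
Qed.

Lemma card_fset_filter (R : realType) (G : choiceType) (F : {fset G}) (P : pred G) :
  (#|` [fset x in F | P x]%fset|)%:R = \sum_(a <- F) (P a)%:R :> R.
Proof.
rewrite card_fset_sum1 natr_sum -big_fset_condE big_mkcond.
by apply: eq_bigr => a _; case: (P a).
Qed.

(** Each application of T costs at most the symmetric difference: a point of F is either outside the
    image of F or of the form [T y] with y in F. *)
Lemma card_preim_approx (G : choiceType) (T : G -> G) (F : {fset G}) (P : pred G) s :
  (#|` [fset x in F | P x]%fset| <=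
   #|` [fset x in F | P (iter s T x)]%fset|
     + s * #|` fsymdiff [fset T x | x in F]%fset F|)%N.
Proof.
elim: s => [|s IH]; first by rewrite mul0n addn0.
apply: (leq_trans IH); rewrite mulSn addnA leq_add2r.
pose Q x := P (iter s T x).
have -> : [fset x in F | P (iter s.+1 T x)]%fset = [fset x in F | Q (T x)]%fset.
  by apply/fsetP => x; rewrite !inE /Q -iterSr.
apply: leq_trans (_ : #|` ([fset T x | x in [fset x in F | Q (T x)]]
    `|` fsymdiff [fset T x | x in F] F)%fset| <= _)%N; last first.
  rewrite cardfsU; apply: leq_trans (leq_subr _ _) _.
  by rewrite leq_add2r leq_imfset_card.
apply: fsubset_leq_card; apply/fsubsetP => x; rewrite !inE /= => /andP[xF Qx].
case: (boolP (x \in [fset T x | x in F]%fset)) => xT /=; last by rewrite xF !orbT.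
apply/orP; left; case/imfsetP: xT => y /= yF xE; apply/imfsetP; exists y => //=.
by rewrite !inE yF /= -xE.
Qed.

Lemma iter_progression (R : realType) (G : groupType) (T : G -> G) (F : nat -> {fset G})
    (L : pred G) :
  (forall n, F n != fset0%fset) -> 0 < limn_sup (fun n => dens_ratio R L (F n)) ->
  (fun n => sd_ratio R [fset T x | x in F n]%fset (F n)) @ \oo --> (0 : R) ->
  forall k, (0 < k)%N -> exists n a, (0 < n)%N /\
    forall j, (j < k)%N -> L (iter (j * n) T a).
Proof.
move=> hF hL hT [//|k] _.
have cF0 n : 0 < (#|` F n|)%:R :> R by rewrite ltr0n cardfs_gt0.
have [|delta d0 hd] := limn_sup_frequently _ hL.
  move=> n; rewrite /dens_ratio divr_ge0 //= ler_pdivrMr // mul1r ler_nat.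
  by apply: fsubset_leq_card; apply/fsubsetP => x; rewrite !inE => /andP[].
have d2 : 0 < delta / 2 by lra.
have [N hN] := @density_hales_jewett R k _ d2.
(* [N * k.+1] bounds the letter sum of a word, hence the number of applications of T; the added 1
   makes c positive. *)
pose c : R := (N * k.+1)%:R + 1.
have c0 : 0 < c by rewrite ltr_wpDl.
have e0 : 0 < delta / 2 / c by rewrite divr_gt0.
have /cvgr0Pnorm_lt /(_ _ e0)[n0 _ hn0] := hT.
have [n nn0 dn] := hd n0; have {hn0} sdn := hn0 n nn0.
pose D := #|` fsymdiff [fset T x | x in F n]%fset (F n)|.
have hD : (N * k.+1)%:R * D%:R <= delta / 2 * (#|` F n|)%:R.
  move: sdn; rewrite /= /sd_ratio ger0_norm ?divr_ge0 // ltr_pdivrMr // -/D => h.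
  have : D%:R * c < delta / 2 * (#|` F n|)%:R.
    by rewrite -ltr_pdivlMr // mulrAC.
  rewrite /c mulrDr mulr1 mulrC; have : 0 <= D%:R :> R by [].
  by lra.
have hw w : w \in words k.+1 N ->
    delta / 2 * (#|` F n|)%:R < \sum_(a <- F n) (L (iter (sumn w) T a))%:R :> R.
  move=> hw; rewrite -(card_fset_filter R (F n) (fun a => L (iter (sumn w) T a))).
  have := card_preim_approx T (F n) L (sumn w); rewrite -/D -(ler_nat R) natrD natrM.
  have : (sumn w <= N * k.+1)%N.
    case/wordsP: hw => <-; elim: (w) => //= a v IH h; rewrite mulSn leq_add //.
      by apply: ltnW; apply: h; rewrite mem_head.
    by apply: IH => b bv; apply: h; rewrite inE bv orbT.
  rewrite -(ler_nat R) => hs.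
  have : (sumn w)%:R * D%:R <= (N * k.+1)%:R * D%:R :> R by rewrite ler_wpM2r.
  move: dn; rewrite /dens_ratio ltr_pdivlMr //; lra.
(* Double counting over the words and the points of [F n]: if every a failed, the average over words
   of the sums in [hw] would be too small. *)
have [a aF ha] : exists2 a, a \in F n &
    delta / 2 <= avg k.+1 N (fun w => (L (iter (sumn w) T a))%:R).
  apply: contrapT => na.
  have : avg k.+1 N (fun w => \sum_(a <- F n) (L (iter (sumn w) T a))%:R)
      <= delta / 2 * (#|` F n|)%:R.
    rewrite avg_sum card_fset_sum1 natr_sum mulr_sumr big_seq [leRHS]big_seq.
    apply: ler_sum => a aF; rewrite mulr1 leNgt; apply/negP => /ltW h.
    by apply: na; exists a.
  apply/negP; rewrite -ltNge.
  rewrite -[ltLHS](avg_cst N _ (ltn0Sn k)) /avg ltr_pM2r ?invr_gt0 ?expn_natr_gt0 //.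
  rewrite big_seq [ltRHS]big_seq; apply: ltr_sum => //.
  by apply/hasP; exists (nseq N 0%N); apply: words_nseq.
have [U /tmplP[/wordsP[_ wU] /(_ 0%N isT)]] := hN N (leqnn _) _ ha.
rewrite addn0 => kU hU.
exists (count_mem k.+1 U), (iter (sumn (sub k.+1 U [:: 0%N])) T a); split.
  by rewrite -has_count has_pred1.
move=> j jk; have := hU [:: j]; rewrite -iterD -sumn_sub_line //.
by apply; apply: words_cons.
Qed.

Theorem mainTheorem1 (R : realType) (G : groupType) (F : nat -> {fset G})
    (b : G) (L : pred G)
    (hF : forall n, F n != fset0)
    (hL : (0 < limn_sup (fun n => dens_ratio R L (F n)))%R) :
  ((fun n => sd_ratio R (ltrans b (F n)) (F n)) @ \oo --> (0 : R)%R ->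
     forall k : nat, (0 < k)%N ->
       exists (n : nat) (a : G), (0 < n)%N /\
         forall j : nat, (j < k)%N -> L ((b ^+ (j * n)) * a)%g)
  /\
  ((fun n => sd_ratio R (rtrans b (F n)) (F n)) @ \oo --> (0 : R)%R ->
     forall k : nat, (0 < k)%N ->
       exists (n : nat) (a : G), (0 < n)%N /\
         forall j : nat, (j < k)%N -> L (a * (b ^+ (j * n)))%g).
Proof.
split=> hb k k0.
  have [n [a [n0 h]]] := iter_progression (T := fun x => (b * x)%g) hF hL hb k0.
  exists n, a; split=> // j /h; congr (L _).
  by elim: (j * n)%N => [|m IH]; rewrite ?mul1g //= IH expgS mulgA.
have [n [a [n0 h]]] := iter_progression (T := fun x => (x * b)%g) hF hL hb k0.
exists n, a; split=> // j /h; congr (L _).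
by elim: (j * n)%N => [|m IH]; rewrite ?mulg1 //= IH expgSr mulgA.
Qed.
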